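(* Let $\mathfrak D$ be the complex mirror Heisenberg-Virasoro algebra and let $\phi:\mathfrak D\to\mathfrak D$ be a linear map. Then $\phi$ is commuting, i.e. $[\phi(x),x]=0$ for all $x\in\mathfrak D$, if and only if there exist $\lambda\in\mathbb C$ and a linear map $\tau:\mathfrak D\to Z(\mathfrak D)$ such that $\phi(x)=\lambda x+\tau(x)$ for all $x\in\mathfrak D$.
   Context: The mirror Heisenberg-Virasoro algebra $\mathfrak D$ is the complex Lie algebra with basis $\{d_m,\ h_r,\ \mathbf c,\ \mathbf l\mid m\in\mathbb Z,\ r\in\frac12+\mathbb Z\}$ and brackets (those not determined by the following and skew-symmetry are zero) $$[d_m,d_n]=(m-n)d_{m+n}+\tfrac{m^3-m}{12}\delta_{m+n,0}\,\mathbf c,\quad [d_m,h_r]=-r\,h_{m+r},\quad [h_r,h_s]=r\,\delta_{r+s,0}\,\mathbf l,$$ for $m,n\in\mathbb Z$, $r,s\in\frac12+\mathbb Z$. $Z(\mathfrak D)=\langle\mathbf c,\mathbf l\rangle$ denotes its centre. *)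

(* Defs.v *)
From HB Require Import structures.
From mathcomp Require Import all_boot all_order all_algebra.
From mathcomp Require Import finmap monalg.
From mathcomp Require Import ring zify.

Set Implicit Arguments.
Unset Strict Implicit.
Unset Printing Implicit Defensive.

Import Order.TTheory GRing.Theory Num.Theory.

Local Open Scope ring_scope.

(* [mhv_h k] stands for h_r with r = k + 1/2, so that k : int enumerates the
   half-odd integers 1/2 + Z; see [half_odd]. *)
Inductive mhv_basis : Type :=
  | mhv_d of int
  | mhv_h of int
  | mhv_c
  | mhv_l.

Definition mhv_basis_code (b : mhv_basis) : (int + int) + bool :=
  match b with
  | mhv_d m => inl (inl m)
  | mhv_h k => inl (inr k)
  | mhv_c => inr true
  | mhv_l => inr false
  end.

Definition mhv_basis_decode (s : (int + int) + bool) : mhv_basis :=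
  match s with
  | inl (inl m) => mhv_d m
  | inl (inr k) => mhv_h k
  | inr true => mhv_c
  | inr false => mhv_l
  end.

Lemma mhv_basis_codeK : cancel mhv_basis_code mhv_basis_decode.
Proof. by case. Qed.

HB.instance Definition _ := Countable.copy mhv_basis (can_type mhv_basis_codeK).

(* The algebra over an arbitrary field K of characteristic 0 with a norm; the
   complex algebra is the instance K := complex R, for R : realType. *)
Definition mirrorHV (K : numFieldType) : Type := {malg K[mhv_basis]}.

HB.instance Definition _ (K : numFieldType) := GRing.Lmodule.on (mirrorHV K).

(* [basis_elt] and [bracket] are locked because unification would otherwise
   unfold them, down to finitely supported functions, when rewriting. *)
HB.lock Definition basis_elt (K : numFieldType) (b : mhv_basis) : mirrorHV K :=
  << b >>.

Section MirrorHeisenbergVirasoro.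
Variable K : numFieldType.

Local Notation D := (mirrorHV K).
Local Notation basis_elt := (@basis_elt K).

Definition half_odd (k : int) : K := k%:~R + 2%:R^-1.

(* In the (h, d) case [h_r, d_m] = r h_{m+r}, by skew-symmetry; the index m + r
   has integer code m + k when r has code k. *)
Definition basis_bracket (a b : mhv_basis) : D :=
  match a, b with
  | mhv_d m, mhv_d n =>
      (m - n)%:~R *: basis_elt (mhv_d (m + n))
      + ((m ^+ 3 - m)%:~R / 12%:R * (m + n == 0)%:R) *: basis_elt mhv_c
  | mhv_d m, mhv_h k => - half_odd k *: basis_elt (mhv_h (m + k))
  | mhv_h k, mhv_d m => half_odd k *: basis_elt (mhv_h (m + k))
  | mhv_h j, mhv_h k =>
      (half_odd j * (half_odd j + half_odd k == 0)%:R) *: basis_elt mhv_l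
  | _, _ => 0
  end.

End MirrorHeisenbergVirasoro.

HB.lock Definition bracket (K : numFieldType) (x y : mirrorHV K) : mirrorHV K :=
  \sum_(a <- msupp x) \sum_(b <- msupp y) (x@_a * y@_b) *: basis_bracket K a b.

Section MirrorHeisenbergVirasoro.
Variable K : numFieldType.

Local Notation D := (mirrorHV K).
Local Notation basis_elt := (@basis_elt K).
Local Notation half_odd := (@half_odd K).
Local Notation basis_bracket := (@basis_bracket K).

Definition central (z : D) : Prop := forall x : D, bracket z x = 0.

Definition commuting (phi : D -> D) : Prop :=
  forall x : D, bracket (phi x) x = 0.

Lemma bracketEw (A B : {fset mhv_basis}) (x y : D) :
  {subset msupp x <= A} -> {subset msupp y <= B} ->
  bracket x y =
  \sum_(a <- A) \sum_(b <- B) (x@_a * y@_b) *: basis_bracket a b.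
Proof.
move=> /fsubsetP xA /fsubsetP yB; rewrite bracket.unlock (big_fset_incl _ xA) /=.
  apply: eq_bigr => a _; apply: big_fset_incl => // b _ /mcoeff_outdom ->.
  by rewrite mulr0 scale0r.
by move=> a _ /mcoeff_outdom ->; rewrite big1 // => b _; rewrite mul0r scale0r.
Qed.

Lemma basis_bracket_skew a b : basis_bracket a b = - basis_bracket b a.
Proof.
have scaleN (s t : K) (u : D) : s = - t -> s *: u = - (t *: u).
  by move=> ->; rewrite scaleNr.
case: a b => [m|j||] [n|k||]; rewrite /Defs.basis_bracket ?oppr0 //.
- rewrite opprD [(n + m)%R]addrC; congr (_ + _); apply: scaleN.
    by rewrite -mulrNz opprB.
  have [mn0|_] := eqVneq (m + n) 0; last by rewrite !mulr0 oppr0.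
  have -> : n = - m by rewrite -(addKr m n) mn0 addr0.
  rewrite !mulr1 -mulNr -mulrNz; congr (_%:~R / _).
  by rewrite !exprS expr0; ring.
- exact: scaleN.
- by apply: scaleN; rewrite opprK.
- apply: scaleN; rewrite addrC; have [jk0|_] := eqVneq; last first.
    by rewrite !mulr0 oppr0.
  by rewrite !mulr1; apply/eqP; rewrite -subr_eq0 opprK addrC jk0.
Qed.

Lemma bracket_skew (x y : D) : bracket x y = - bracket y x.
Proof.
rewrite !bracket.unlock exchange_big -sumrN; apply: eq_bigr => b _.
rewrite -sumrN; apply: eq_bigr => a _.
by rewrite basis_bracket_skew scalerN mulrC.
Qed.

Lemma bracket_linearl (y : D) : linear (fun x => bracket x y).
Proof.
move=> t u v; pose A := (msupp u `|` msupp v)%fset.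
have sA (w : D) : {subset msupp w <= A} ->
  bracket w y =
  \sum_(a <- A) \sum_(b <- msupp y) (w@_a * y@_b) *: basis_bracket a b.
  by move=> wA; apply: bracketEw.
rewrite !sA ?scaler_sumr -?big_split /=.
- apply: eq_bigr => a _; rewrite scaler_sumr -big_split /=.
  apply: eq_bigr => b _; rewrite scalerA -scalerDl mulrA -mulrDl.
  by rewrite mcoeffD mcoeffZ.
- by move=> a; rewrite in_fsetU => ->; rewrite orbT.
- by move=> a; rewrite in_fsetU => ->.
- move=> a /(fsubsetP (msuppD_le _ _)); rewrite !in_fsetU.
  by case/orP => [/(fsubsetP (msuppZ_le _ _)) -> //|->]; rewrite orbT.
Qed.

Lemma bracket_linearr (x : D) : linear (bracket x).
Proof.
move=> t u v; rewrite bracket_skew bracket_linearl opprD -scalerN.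
by rewrite -!(bracket_skew x).
Qed.

Lemma bracket_basis (a b : mhv_basis) :
  bracket (basis_elt a) (basis_elt b) = basis_bracket a b.
Proof.
by rewrite bracket.unlock basis_elt.unlock !msuppU oner_eq0 !big_seq_fset1 !mcoeffUU mulr1 scale1r.
Qed.

Lemma bracketxx (x : D) : bracket x x = 0.
Proof.
have /eqP := bracket_skew x x; rewrite -subr_eq0 opprK -mulr2n -scaler_nat.
move=> /eqP xx0; rewrite -[LHS]scale1r -[1](@mulVf _ 2%:R) ?pnatr_eq0 //.
by rewrite -scalerA xx0 scaler0.
Qed.

HB.instance Definition _ x := GRing.isLinear.Build K D D _ (bracket x)
  (bracket_linearr x).

Lemma basis_eltE (x : D) : x = \sum_(a <- msupp x) x@_a *: basis_elt a.
Proof.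
rewrite [LHS]monalgE; apply: eq_bigr => a _; apply/malgP => b.
by rewrite mcoeffZ basis_elt.unlock !mcoeffU mulrnAr mulr1.
Qed.

Lemma linear_basis_eq0 (f : D -> D) :
  linear f -> (forall a, f (basis_elt a) = 0) -> forall x, f x = 0.
Proof.
move=> lf f0 x; pose fL := GRing.isLinear.Build K D D _ f lf.
pose F : {linear D -> D} := HB.pack f fL.
rewrite -[f]/(F : D -> D) (basis_eltE x) linear_sum big1 // => a _.
by rewrite linearZ /= f0 scaler0.
Qed.

Lemma bracketZl t (x y : D) : bracket (t *: x) y = t *: bracket x y.
Proof. by rewrite bracket_skew linearZ /= -scalerN -bracket_skew. Qed.

Lemma bracketDl (x y z : D) : bracket (x + y) z = bracket x z + bracket y z.
Proof. by rewrite bracket_skew linearD opprD -!(bracket_skew _ z). Qed.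

Lemma bracket0l (x : D) : bracket 0 x = 0.
Proof. by rewrite bracket_skew linear0 oppr0. Qed.

Definition jacobiator (x y z : D) : D :=
  bracket x (bracket y z) + bracket y (bracket z x) + bracket z (bracket x y).

Lemma jacobiatorC (x y z : D) : jacobiator x y z = jacobiator y z x.
Proof. by rewrite /jacobiator -addrA addrC. Qed.

Lemma jacobiatorN (x y z : D) : jacobiator x y z = - jacobiator x z y.
Proof.
rewrite /jacobiator (bracket_skew y z) (bracket_skew z x) (bracket_skew x y).
by rewrite !linearN -!opprD addrAC.
Qed.

Lemma jacobiator_linear (x y : D) : linear (jacobiator x y).
Proof.
move=> t u v; rewrite /jacobiator.
have -> : bracket y (bracket (t *: u + v) x) =
    t *: bracket y (bracket u x) + bracket y (bracket v x).
  by rewrite bracketDl bracketZl linearP.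
have -> : bracket x (bracket y (t *: u + v)) =
    t *: bracket x (bracket y u) + bracket x (bracket y v).
  by rewrite !linearP.
rewrite bracketDl bracketZl !scalerDr.
by rewrite [LHS](AC (2*2*2) ((1*3*5)*(2*4*6))).
Qed.

Lemma bracket_center_basis (x : D) :
  bracket (basis_elt mhv_c) x = 0 /\ bracket (basis_elt mhv_l) x = 0.
Proof.
by split; apply: linear_basis_eq0 x => [|[]*]; rewrite ?bracket_basis //;
   exact: bracket_linearr.
Qed.

Lemma mhv_hP j k : (half_odd j + half_odd k == 0) = (j + k + 1 == 0).
Proof.
rewrite -(intr_eq0 K) !intrD mulr1z /half_odd; congr (_ == 0); by field.
Qed.

Lemma jacobi_basis a b c :
  jacobiator (basis_elt a) (basis_elt b) (basis_elt c) = 0.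
Proof.
have cl x := (bracket_center_basis x).
have c0 x := (cl x).1; have l0 x := (cl x).2.
have c0r x : bracket x (basis_elt mhv_c) = 0 by rewrite bracket_skew c0 oppr0.
have l0r x : bracket x (basis_elt mhv_l) = 0 by rewrite bracket_skew l0 oppr0.
have cz x y t : bracket x (y + t *: basis_elt mhv_c) = bracket x y.
  by rewrite linearD linearZ /= c0r scaler0 addr0.
have Jc y z : jacobiator (basis_elt mhv_c) y z = 0.
  by rewrite /jacobiator !c0 c0r !linear0 !addr0.
have Jl y z : jacobiator (basis_elt mhv_l) y z = 0.
  by rewrite /jacobiator !l0 l0r !linear0 !addr0.
have Jddd m n p : jacobiator (basis_elt (mhv_d m)) (basis_elt (mhv_d n))
    (basis_elt (mhv_d p)) = 0.
  rewrite /jacobiator !bracket_basis /= !cz !linearZ /= !bracket_basis.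
  rewrite /= !scalerDr !scalerA.
  rewrite [n + (p + m)](_ : _ = m + (n + p)); last by ring.
  rewrite [p + (m + n)](_ : _ = m + (n + p)); last by ring.
  rewrite [LHS](AC (2*2*2) ((1*3*5)*(2*4*6))) /= -!scalerDl.
  rewrite [X in X *: _](_ : _ = 0) ?scale0r ?add0r; last first.
    by ring.
  rewrite [X in X *: _](_ : _ = 0) ?scale0r //.
  have [e|_] := eqVneq; last by rewrite !mulr0 !addr0.
  have -> : m = - (n + p) by rewrite -(addrK (n + p) m) e add0r.
  by rewrite !mulr1; field.
have Jddh m n k : jacobiator (basis_elt (mhv_d m)) (basis_elt (mhv_d n))
    (basis_elt (mhv_h k)) = 0.
  rewrite /jacobiator !bracket_basis /= !cz !linearZ /= !bracket_basis.
  rewrite /= !scalerA.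
  rewrite [n + (m + k)](_ : _ = m + (n + k)); last by ring.
  rewrite [m + n + k](_ : _ = m + (n + k)); last by ring.
  rewrite -!scalerDl [X in X *: _](_ : _ = 0) ?scale0r //.
  by rewrite /half_odd; field.
have Jdhh m j k : jacobiator (basis_elt (mhv_d m)) (basis_elt (mhv_h j))
    (basis_elt (mhv_h k)) = 0.
  rewrite /jacobiator !bracket_basis /= !linearZ /= !l0r !bracket_basis.
  rewrite /= !scaler0 add0r !scalerA !mhv_hP.
  rewrite [k + (m + j) + 1](_ : _ = j + (m + k) + 1); last by ring.
  rewrite -!scalerDl [X in X *: _](_ : _ = 0) ?scale0r //.
  have [e|_] := eqVneq; last by rewrite !mulr0 !addr0.
  have -> : j = - (m + k + 1).
    by apply/eqP; rewrite -subr_eq0 opprK -e; apply/eqP; ring.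
  by rewrite !mulr1 /half_odd; field.
have Jhhh i j k : jacobiator (basis_elt (mhv_h i)) (basis_elt (mhv_h j))
    (basis_elt (mhv_h k)) = 0.
  by rewrite /jacobiator !bracket_basis /= !linearZ /= !l0r !scaler0 !addr0.
case: a b c => [m|m||] [n|n||] [p|p||] //;
 do ![by rewrite ?Jc ?Jl ?Jddd ?Jddh ?Jdhh ?Jhhh
     |rewrite jacobiatorC; by rewrite ?Jc ?Jl ?Jddd ?Jddh ?Jdhh ?Jhhh
     |rewrite -jacobiatorC; by rewrite ?Jc ?Jl ?Jddd ?Jddh ?Jdhh ?Jhhh].
Qed.

Lemma bracket_jacobi (x y z : D) :
  bracket x (bracket y z) + bracket y (bracket z x) + bracket z (bracket x y)
  = 0.
Proof.
rewrite -/(jacobiator x y z); move: z; apply: linear_basis_eq0 => [|c].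
  exact: jacobiator_linear.
rewrite -jacobiatorC; move: y; apply: linear_basis_eq0 => [|b].
  exact: jacobiator_linear.
rewrite -jacobiatorC; move: x; apply: linear_basis_eq0 => [|a].
  exact: jacobiator_linear.
by rewrite -jacobiatorC jacobi_basis.
Qed.

Lemma centralP (z : D) :
  central z <->
  exists s t : K, z = s *: basis_elt mhv_c + t *: basis_elt mhv_l.
Proof.
split=> [zC|[s [t ->]] x]; last first.
  have [c0 l0] := bracket_center_basis x.
  by rewrite bracketDl !bracketZl c0 l0 !scaler0 addr0.
have coefb k b : (bracket z (basis_elt b))@_k =
    \sum_(a <- msupp z) z@_a * (basis_bracket a b)@_k.
  rewrite bracket.unlock basis_elt.unlock msuppU oner_eq0 raddf_sum /=.
  by apply: eq_bigr => a _; rewrite big_seq_fset1 mcoeffUU mulr1 mcoeffZ.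
have coef1 b k a0 : (forall a, a != a0 -> (basis_bracket a b)@_k = 0) ->
    (basis_bracket a0 b)@_k != 0 -> z@_a0 = 0.
  move=> h0 nz; apply/eqP; apply: contraTT isT => za0.
  have a0z : a0 \in msupp z by rewrite -mcoeff_neq0.
  have := congr1 (mcoeff k) (zC (basis_elt b)).
  rewrite coefb mcoeff0 (bigD1_seq a0) ?fset_uniq //= big1 => [|a /h0 ->];
    last by rewrite mulr0.
  by move/eqP; rewrite addr0 mulf_eq0 (negbTE za0) (negbTE nz).
have dm m : z@_(mhv_d m) = 0.
  have [->|m0] := eqVneq m 0.
    apply: (coef1 (mhv_d 1) (mhv_d 1)) => [[n|k||] n0|];
      rewrite ?mcoeff0 //= ?mcoeffD ?mcoeffZ basis_elt.unlock !mcoeffU /=.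
    - rewrite mulr0 addr0 (_ : (mhv_d _ == _) = (n == 0)); last first.
        by rewrite -[RHS](inj_eq (addIr 1)) add0r.
      by rewrite -[n == 0]/(mhv_d n == mhv_d 0) (negbTE n0) mulr0.
    - by rewrite mulr0.
    - by rewrite ?add0r ?eqxx mulr0 addr0 mulr1 ?sub0r ?mulrN1z oppr_eq0 oner_eq0.
  apply: (coef1 (mhv_d 0) (mhv_d m)) => [[n|k||] n0|];
      rewrite ?mcoeff0 //= ?mcoeffD ?mcoeffZ basis_elt.unlock !mcoeffU /=.
  - by rewrite mulr0 addr0 addr0 (negbTE n0) mulr0.
  - by rewrite mulr0.
  - by rewrite addr0 eqxx mulr0 addr0 mulr1 ?subr0 intr_eq0.
have hk k : z@_(mhv_h k) = 0.
  apply: (coef1 (mhv_d 0) (mhv_h k)) => [[n|j||] n0|];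
      rewrite ?mcoeff0 //= ?mcoeffD ?mcoeffZ basis_elt.unlock !mcoeffU /=.
  - by rewrite !mulr0 addr0.
  - by rewrite add0r (negbTE n0) mulr0.
  - rewrite add0r eqxx mulr1; apply: contraTneq isT => h0.
    have : half_odd k + half_odd k == 0 by rewrite h0 addr0.
    by rewrite mhv_hP; lia.
exists z@_mhv_c, z@_mhv_l; apply/malgP => -[m|k||];
  by rewrite mcoeffD !mcoeffZ basis_elt.unlock !mcoeffU /= ?dm ?hk
             ?mulr0 ?mulr1 ?addr0 ?add0r.
Qed.

End MirrorHeisenbergVirasoro.

(* Main.v *)
Require Import Defs.
From HB Require Import structures.
From mathcomp Require Import all_boot all_order all_algebra.
From mathcomp Require Import finmap monalg.
From mathcomp Require Import zify.
From mathcomp Require Import reals complex.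

(** The algebra is graded by the eigenvalues of d_0: the bracket with d_0
    multiplies each basis vector by its weight, which is m on d_m, r on h_r and
    0 on the centre.  As r is half-odd, only d_0 and the central elements have
    weight 0, so the centralizer of d_0 is the line of d_0 plus the centre
    ([centralizer_d0]).

    Polarizing [phi x, x] = 0 shows that a commuting map moves across the
    bracket: [phi x, y] = [x, phi y] ([commuting_swap]).  Since phi d_0
    commutes with d_0, it is lambda d_0 modulo the centre for some lambda.  Put
    tau = phi - lambda id, which is again commuting, with tau d_0 central.  By
    the swap every tau x commutes with d_0, hence lies on the line of d_0 modulo
    the centre.  In particular tau d_1 is a d_0 plus a central element, and
    [tau d_1, d_1] = 0 forces a = 0 because [d_0, d_1] = - d_1.  So tau d_1 is
    central, and by the swap every tau x commutes with d_1 too; as d_0 and d_1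
    have no common centralizer beyond the centre ([centralizer_d0_d1]), tau x is
    central.  The converse is the bilinearity of the bracket. *)

Import Order.TTheory GRing.Theory Num.Theory.

Local Open Scope ring_scope.

Section CommutingMaps.
Variable K : numFieldType.

Local Notation D := (mirrorHV K).
Local Notation d m := (basis_elt K (mhv_d m)).

Lemma half_odd_neq0 (k : int) : half_odd K k != 0.
Proof.
apply: contraTneq isT => k0.
have : half_odd K k + half_odd K k == 0 by rewrite k0 addr0.
by rewrite mhv_hP; lia.
Qed.

Definition weight (b : mhv_basis) : K :=
  match b with
  | mhv_d m => m%:~R
  | mhv_h k => half_odd K k
  | _ => 0
  end.

(** The cocycle term of [d_m, d_0] lives at m = 0, where m^3 - m vanishes. *)
Lemma basis_bracket_d0 (b : mhv_basis) :
  basis_bracket K b (mhv_d 0) = weight b *: basis_elt K b.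
Proof.
case: b => [m|k||] /=; rewrite ?scale0r ?add0r //.
rewrite subr0; have [->|_] := eqVneq m 0.
  by rewrite expr0n subr0 !mul0r !scale0r addr0.
by rewrite mulr0 scale0r addr0.
Qed.

Lemma bracket_d0_coef (z : D) (b : mhv_basis) :
  (bracket z (d 0))@_b = z@_b * weight b.
Proof.
rewrite bracket.unlock basis_elt.unlock msuppU oner_eq0 raddf_sum /=.
under eq_bigr => a _.
  rewrite big_seq_fset1 mcoeffUU mulr1 basis_bracket_d0 basis_elt.unlock.
  rewrite !mcoeffZ mcoeffU; over.
have [bz|bz] := boolP (b \in msupp z).
  rewrite (bigD1_seq b) ?fset_uniq //= eqxx mulr1 big1 ?addr0 // => a /negPf ->.
  by rewrite !mulr0.
rewrite (mcoeff_outdom bz) mul0r big1_seq // => a /andP[_ az].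
by rewrite (_ : a == b = false) ?mulr0 //; apply: contraNF bz => /eqP <-.
Qed.

Lemma centralizer_d0 (z : D) :
  bracket z (d 0) = 0 -> central (z - z@_(mhv_d 0) *: d 0).
Proof.
move=> z0; have zb b : weight b != 0 -> z@_b = 0.
  move=> b0; have /eqP := bracket_d0_coef z b.
  by rewrite z0 mcoeff0 eq_sym mulf_eq0 (negPf b0) orbF => /eqP.
apply/centralP; exists z@_mhv_c, z@_mhv_l; apply/malgP => b.
rewrite mcoeffB mcoeffD !mcoeffZ basis_elt.unlock !mcoeffU.
case: b => [m|k||] /=; rewrite ?mulr0 ?mulr1 ?subr0 ?addr0 ?add0r //.
  have [->|m0] := eqVneq m 0; first by rewrite eqxx mulr1 subrr.
  rewrite (zb (mhv_d m)) ?intr_eq0 //.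
  by case: eqP => [[m0']|_]; [rewrite -m0' eqxx in m0|rewrite mulr0 subr0].
by rewrite zb //= half_odd_neq0.
Qed.

(** Modulo the centre z is a d_0, and a d_0 commutes with d_1 only if a = 0,
    since [d_0, d_1] = - d_1. *)
Lemma centralizer_d0_d1 (z : D) :
  bracket z (d 0) = 0 -> bracket z (d 1) = 0 -> central z.
Proof.
move=> /centralizer_d0 zC z1; move: (zC); set a := z@_(mhv_d 0) => zaC.
have d01 : bracket (d 0) (d 1) = - d 1.
  rewrite bracket_basis /= add0r sub0r mulr0 scale0r addr0.
  by rewrite mulrN1z scaleN1r.
have a0 : a = 0.
  have /(congr1 (mcoeff (mhv_d 1))) := zaC (d 1).
  rewrite bracketDl z1 add0r -scaleNr bracketZl d01 scalerN scaleNr opprK.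
  by rewrite mcoeff0 mcoeffZ basis_elt.unlock mcoeffUU mulr1.
by move: zaC; rewrite a0 scale0r subr0.
Qed.

(** Expand [f (x + y), x + y] = 0: the cross terms [f x, y] and [f y, x] cancel. *)
Lemma commuting_swap (f : {linear D -> D}) (x y : D) :
  commuting f -> bracket (f x) y = bracket x (f y).
Proof.
move=> fC; have := fC (x + y).
rewrite (linearD f) bracketDl !linearD /= !fC add0r addr0 => /eqP.
by rewrite addr_eq0 -bracket_skew => /eqP.
Qed.

Lemma central_bracketr (z x : D) : central z -> bracket x z = 0.
Proof. by move=> zC; rewrite bracket_skew zC oppr0. Qed.

(** Each f x commutes with d_0, because the swap turns [f x, d_0] into
    [x, f d_0].  Hence f d_1 commutes with d_0, and with d_1 because f is
    commuting, so it is central; the swap with d_1 then does the same for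
    every f x. *)
Lemma commuting_central (f : {linear D -> D}) :
  commuting f -> central (f (d 0)) -> forall x, central (f x).
Proof.
move=> fC f0; have fx0 x : bracket (f x) (d 0) = 0.
  by rewrite commuting_swap // central_bracketr.
have f1 : central (f (d 1)) by apply: centralizer_d0_d1.
move=> x; apply: centralizer_d0_d1 => //.
by rewrite commuting_swap // central_bracketr.
Qed.

Lemma commutingP (phi : {linear D -> D}) :
  commuting phi <->
  exists (lambda : K) (tau : {linear D -> D}),
    (forall x : D, central (tau x)) /\
    (forall x : D, phi x = lambda *: x + tau x).
Proof.
split=> [phiC|[lambda [tau [tauC phiE]]] x]; last first.
  by rewrite phiE bracketDl bracketZl bracketxx scaler0 add0r tauC.
pose lambda := (phi (d 0))@_(mhv_d 0).
pose tau : {linear D -> D} := phi \- (lambda \*: idfun).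
have tauE x : tau x = phi x - lambda *: x by [].
exists lambda, tau; split=> [|x]; last by rewrite tauE addrC subrK.
apply: commuting_central => [x|].
  by rewrite tauE bracketDl phiC -scaleNr bracketZl bracketxx scaler0 addr0.
by rewrite tauE; exact/centralizer_d0/phiC.
Qed.

End CommutingMaps.

Theorem theorem8 (R : realType)
    (phi : {linear mirrorHV (complex R) -> mirrorHV (complex R)}) :
  commuting phi <->
  exists (lambda : complex R)
         (tau : {linear mirrorHV (complex R) -> mirrorHV (complex R)}),
    (forall x : mirrorHV (complex R), central (tau x)) /\
    (forall x : mirrorHV (complex R), phi x = lambda *: x + tau x).
Proof. exact: commutingP. Qed.
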